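(* Let $n\ge 2$, let $b,b'\in\mathbb{C}$, and let $A$ and $A'$ be irreducible modules over the associative algebra $\mathcal{K}_n$. Then $A_b\cong A'_{b'}$ as $\mathcal{W}_n$-modules if and only if $b=b'$ and $A\cong A'$ as $\mathcal{K}_n$-modules.
   Context: All vector spaces and algebras are over $\mathbb{C}$. $\mathcal{A}_n=\mathbb{C}[t_1^{\pm1},\dots,t_n^{\pm1}]$ is the Laurent polynomial algebra and $\partial_i=t_i\frac{\partial}{\partial t_i}$. For $r=(r_1,\dots,r_n)\in\mathbb{Z}^n$ and $u=(u_1,\dots,u_n)\in\mathbb{C}^n$ put $t^r=t_1^{r_1}\cdots t_n^{r_n}$, $D(u,r)=t^r\sum_{i=1}^n u_i\partial_i$, and $(u|v)=\sum_i u_iv_i$ for $u,v\in\mathbb{C}^n$. The Witt algebra $\mathcal{W}_n$ is the Lie algebra of all derivations of $\mathcal{A}_n$; it is spanned by the $D(u,r)$ ($u\in\mathbb{C}^n$, $r\in\mathbb{Z}^n$), with $[D(u,r),D(v,s)]=D(w,r+s)$, $w=(u|s)v-(v|r)u$. $\mathcal{K}_n=\mathbb{C}[t_1^{\pm1},\dots,t_n^{\pm1},\partial_1,\dots,\partial_n]$ is the associative algebra of differential operators on $\mathcal{A}_n$ generated by multiplication by $t_i^{\pm1}$ and by the $\partial_i$. For a $\mathcal{K}_n$-module $A$ and $b\in\mathbb{C}$, $A_b$ denotes the $\mathcal{W}_n$-module with underlying space $A$ and action $D(u,k)\circ v=D(u,k)v+b(u|k)t^kv$ for $u\in\mathbb{C}^n$,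 $k\in\mathbb{Z}^n$, $v\in A$ (on the right-hand side, elements of $\mathcal{K}_n$ act on $A$). *)

(* Defs.v *)
From HB Require Import structures.
From mathcomp Require Import all_boot all_order all_algebra.
From mathcomp Require Import finmap monalg.
From mathcomp Require Import boolp reals complex.
From mathcomp Require Import ring.

Set Implicit Arguments.
Unset Strict Implicit.
Unset Printing Implicit Defensive.

Import GRing.Theory.
Local Open Scope ring_scope.

(* The Laurent polynomial algebra F[t_1^{+-1}, ..., t_n^{+-1}]: finitely
   supported functions on Z^n, i.e. the group algebra of Z^n.  The ring
   structure of {malg _} is not available here, because it requires a monoid of
   exponents in which 0 is the only invertible element. *)
Definition laurent (F : fieldType) (n : nat) := {malg F['rV[int]_n]}.

HB.instance Definition _ (F : fieldType) (n : nat) :=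
  GRing.Zmodule.copy (laurent F n) {malg F['rV[int]_n]}.

(* Scaling, monomials and products are locked, to keep unification from
   unfolding them. *)
HB.lock Definition lscale (F : fieldType) (n : nat) (a : F) (f : laurent F n) :
  laurent F n := a *: (f : {malg F['rV[int]_n]}).
Arguments lscale {F n} a f.

Section LaurentLmodule.
Variables (F : fieldType) (n : nat).
Local Notation L := (laurent F n).
Implicit Types (f g : L) (a c : F).

Lemma lscaleA a c f : lscale a (lscale c f) = lscale (a * c) f.
Proof. by rewrite lscale.unlock scalerA. Qed.

Lemma lscale1 : left_id 1 (@lscale F n).
Proof. by move=> f; rewrite lscale.unlock scale1r. Qed.

Lemma lscaleDr : right_distributive (@lscale F n) +%R.
Proof. by move=> a f g; rewrite lscale.unlock; apply: scalerDr. Qed.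

Lemma lscaleDl f : {morph (@lscale F n)^~ f : a c / a + c}.
Proof. by move=> a c; rewrite lscale.unlock; apply: scalerDl. Qed.

HB.instance Definition _ :=
  GRing.Zmodule_isLmodule.Build F L lscaleA lscale1 lscaleDr lscaleDl.

Lemma mcoeff_scale a f k : (a *: f)@_k = a * f@_k.
Proof. by rewrite -[a *: f]/(lscale a f) lscale.unlock mcoeffZ. Qed.

End LaurentLmodule.

(* The monomial t^k. *)
HB.lock Definition lmonom (F : fieldType) (n : nat) (k : 'rV[int]_n) :
  laurent F n := << k >>.
Arguments lmonom {F n} k.

HB.lock Definition lmul (F : fieldType) (n : nat) (f g : laurent F n) :
  laurent F n :=
  \sum_(k <- msupp f) \sum_(l <- msupp g) (f@_k * g@_l) *: lmonom (k + l).
Arguments lmul {F n} f g.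

Section LaurentAlgebra.
Variables (F : fieldType) (n : nat).
Local Notation L := (laurent F n).
Implicit Types (f g h : L) (k l m : 'rV[int]_n) (a c : F).

Lemma mcoeff_lmonom k l : (lmonom k : L)@_l = (k == l)%:R.
Proof. by rewrite lmonom.unlock mcoeffU. Qed.

Lemma lmonomU c k : (<< c *g k >> : L) = c *: lmonom k.
Proof.
apply/malgP => l; rewrite mcoeff_scale mcoeff_lmonom mcoeffU.
by rewrite mulr_natr.
Qed.

Lemma laurentE f : f = \sum_(k <- msupp f) f@_k *: lmonom k.
Proof.
rewrite {1}(monalgE f); apply: eq_bigr => k _; exact: lmonomU.
Qed.

Lemma laurent_ind (P : L -> Prop) :
  (forall c k, P (c *: lmonom k)) -> P 0 ->
  (forall f g, P f -> P g -> P (f + g)) -> forall f, P f.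
Proof.
move=> PU P0 PD f; rewrite (laurentE f).
by elim/big_rec: _ => [//|k g _]; apply: PD.
Qed.

Lemma lmulw (d e : {fset 'rV[int]_n}) f g :
  (msupp f `<=` d)%fset -> (msupp g `<=` e)%fset ->
  lmul f g = \sum_(k <- d) \sum_(l <- e) (f@_k * g@_l) *: lmonom (k + l).
Proof.
move=> sd se; rewrite lmul.unlock (big_fset_incl _ sd) /=.
  apply: eq_bigr => k _; apply: big_fset_incl => // l _ /mcoeff_outdom ->.
  by rewrite mulr0 scale0r.
move=> k _ /mcoeff_outdom fk; rewrite big1 // => l _.
by rewrite fk mul0r scale0r.
Qed.

Lemma lmulUU a c k l :
  lmul (a *: lmonom k) (c *: lmonom l) = (a * c) *: lmonom (k + l) :> L.
Proof.
rewrite -!lmonomU (lmulw msuppU_le msuppU_le) !big_seq_fset1 !mcoeffUU.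
exact/esym/lmonomU.
Qed.

Lemma lmulC : commutative (@lmul F n).
Proof.
move=> f g; rewrite lmul.unlock exchange_big /=; apply: eq_bigr => k _.
by apply: eq_bigr => l _; rewrite mulrC addrC.
Qed.

Lemma lmulDl : left_distributive (@lmul F n) +%R.
Proof.
move=> f g h; have s := fsubset_refl (msupp h).
rewrite (lmulw (msuppD_le f g) s) (lmulw (fsubsetUl _ (msupp g)) s).
rewrite (lmulw (fsubsetUr (msupp f) _) s) -big_split; apply: eq_bigr => k _ /=.
by rewrite -big_split; apply: eq_bigr => l _ /=;
rewrite mcoeffD mulrDl scalerDl.
Qed.

Lemma lmulDr : right_distributive (@lmul F n) +%R.
Proof. by move=> f g h; rewrite lmulC lmulDl ![lmul _ f]lmulC. Qed.

Lemma lmul0 : left_zero 0 (@lmul F n).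
Proof. by move=> f; rewrite lmul.unlock msupp0 big_seq_fset0. Qed.

Lemma lmulr0 : right_zero 0 (@lmul F n).
Proof. by move=> f; rewrite lmulC lmul0. Qed.

Lemma lmulA : associative (@lmul F n).
Proof.
move=> f g h; elim/laurent_ind: f => [a k||f f' ef ef'].
- elim/laurent_ind: g => [c l||g g' eg eg'].
  + elim/laurent_ind: h => [d m||h h' eh eh'].
    * by rewrite !lmulUU mulrA addrA.
    * by rewrite !lmulr0.
    * by rewrite !lmulDr eh eh'.
  + by rewrite lmul0 !lmulr0 lmul0.
  + by rewrite lmulDl !lmulDr lmulDl eg eg'.
- by rewrite !lmul0.
- by rewrite !lmulDl ef ef'.
Qed.

Lemma lmul1 : left_id (lmonom 0) (@lmul F n).
Proof.
move=> f; elim/laurent_ind: f => [a k||f g ef eg].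
- by rewrite -[lmonom 0]scale1r lmulUU mul1r add0r.
- by rewrite lmulr0.
- by rewrite lmulDr ef eg.
Qed.

Lemma lmonom_neq0 k : lmonom k != 0 :> L.
Proof. by rewrite lmonom.unlock monalgU_eq0 oner_eq0. Qed.

HB.instance Definition _ :=
  GRing.Zmodule_isComNzRing.Build L lmulA lmulC lmul1 lmulDl (lmonom_neq0 0).

Lemma lmonom0 : lmonom 0 = 1 :> L.
Proof. by []. Qed.

Lemma lscaleAl a f g : a *: (f * g) = (a *: f) * g.
Proof.
rewrite -[f * g]/(lmul f g) -[RHS]/(lmul (a *: f) g).
elim/laurent_ind: f => [c k||f f' ef ef'].
- elim/laurent_ind: g => [d l||g g' eg eg'].
  + by rewrite lmulUU !scalerA lmulUU mulrA.
  + by rewrite !lmulr0 scaler0.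
  + by rewrite !lmulDr scalerDr eg eg'.
- by rewrite scaler0 !lmul0 scaler0.
- by rewrite lmulDl !scalerDr lmulDl ef ef'.
Qed.

HB.instance Definition _ := GRing.Lmodule_isLalgebra.Build F L lscaleAl.
HB.instance Definition _ := GRing.Lalgebra_isComAlgebra.Build F L.

Lemma lmonomM k l : lmonom k * lmonom l = lmonom (k + l) :> L.
Proof.
rewrite -[LHS]/(lmul _ _) -[lmonom k]scale1r -[lmonom l]scale1r lmulUU.
by rewrite mulr1 scale1r.
Qed.

Lemma lmonom_ind (P : L -> Prop) :
  P 1 -> (forall f g, P f -> P g -> P (f * g)) ->
  (forall i, P (lmonom (delta_mx 0 i))) ->
  (forall i, P (lmonom (- delta_mx 0 i))) -> forall k, P (lmonom k).
Proof.
move=> P1 PM Pt PV k; rewrite (row_sum_delta k).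
elim/big_rec: _ => [|i l _ Pl]; first by rewrite lmonom0.
rewrite -lmonomM; apply: (PM) => //.
have powP l' (m : nat) : P (lmonom l') -> P (lmonom (l' *+ m)).
  move=> Pl'; elim: m => [|m IH]; first by rewrite lmonom0.
  by rewrite mulrS -lmonomM; apply: (PM).
case: (k 0 i) => m.
  by rewrite -[Posz m]natz scaler_nat; apply: powP.
by rewrite NegzE -[Posz _]natz scaleNr scaler_nat -mulNrn; apply: powP.
Qed.

Lemma lmonomK k : lmonom k * lmonom (- k) = 1 :> L.
Proof. by rewrite lmonomM subrr. Qed.

(* The derivation t_i d/dt_i, which maps t^k to k_i t^k. *)
Definition lpartial (i : 'I_n) f : L :=
  \sum_(k <- msupp f) ((k 0 i)%:~R * f@_k) *: lmonom k.

Lemma mcoeff_lpartial i f k : (lpartial i f)@_k = (k 0 i)%:~R * f@_k.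
Proof.
rewrite {2}(laurentE f) /lpartial !(raddf_sum (mcoeff k)) mulr_sumr.
apply: eq_bigr => /= l _; rewrite !mcoeff_scale mcoeff_lmonom.
by case: eqP => [->|_]; rewrite ?mulrA ?mulr0.
Qed.

Lemma lpartial_is_linear i : linear (lpartial i).
Proof.
move=> a f g; apply/malgP => k.
rewrite mcoeffD mcoeff_scale !mcoeff_lpartial mcoeffD mcoeff_scale mulrDr.
by congr (_ + _); rewrite mulrCA.
Qed.

HB.instance Definition _ i :=
  GRing.isLinear.Build F L L *:%R (lpartial i) (lpartial_is_linear i).

Lemma lpartial_monom i k : lpartial i (lmonom k) = (k 0 i)%:~R *: lmonom k.
Proof.
apply/malgP => l; rewrite mcoeff_lpartial mcoeff_scale mcoeff_lmonom.
by case: eqP => [->|_] //; rewrite !mulr0.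
Qed.

Lemma lpartialM i f g : lpartial i (f * g) = lpartial i f * g + f * lpartial i g.
Proof.
elim/laurent_ind: f => [c k||f f' ef ef'].
- elim/laurent_ind: g => [d l||g g' eg eg'].
  + rewrite -!scalerAl -!scalerAr !linearZ /= !lpartial_monom lmonomM.
    rewrite lpartial_monom mxE rmorphD /= -!scalerAl -!scalerAr !lmonomM.
    rewrite !scalerA -scalerDl; congr (_ *: _).
    by rewrite mulrDr !mulrA [d * c]mulrC.
  + by rewrite !mulr0 linear0 mulr0 addr0.
  + by rewrite !mulrDr linearD /= eg eg' linearD /= mulrDr addrACA.
- by rewrite !mul0r linear0 mul0r addr0.
- by rewrite !mulrDl linearD /= ef ef' linearD /= mulrDl addrACA.
Qed.

Lemma lpartialC i j f : lpartial i (lpartial j f) = lpartial j (lpartial i f).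
Proof. by apply/malgP => k; rewrite !mcoeff_lpartial mulrCA. Qed.

End LaurentAlgebra.

(* The algebra of F-linear endomorphisms of the Laurent polynomial algebra,
   with composition as product. *)
Definition lendo (F : fieldType) (n : nat) :=
  {linear laurent F n -> laurent F n}.

Section Endomorphisms.
Variables (F : fieldType) (n : nat).
Local Notation L := (laurent F n).
Local Notation E := (lendo F n).
Implicit Types (p q r : E) (f g h : L) (a c : F).

HB.instance Definition _ := gen_eqMixin E.
HB.instance Definition _ := gen_choiceMixin E.

Lemma lendoP p q : (forall f, p f = q f) -> p = q.
Proof.
case: p q => [p cp] [q cq] /= /funext epq; move: cp cq; rewrite -{q}epq.
move=> [[ap] [bp]] [[aq] [bq]].
by rewrite (Prop_irrelevance ap aq) (Prop_irrelevance bp bq).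
Qed.

Definition lendo_zero : E := \0.
Definition lendo_opp p : E := \- p.
Definition lendo_add p q : E := p \+ q.
Definition lendo_one : E := idfun.
Definition lendo_mul p q : E := p \o q.
Definition lendo_scale a p : E := a \*: p.

Lemma lendo_addA : associative lendo_add.
Proof. by move=> p q r; apply: lendoP => f /=; rewrite addrA. Qed.

Lemma lendo_addC : commutative lendo_add.
Proof. by move=> p q; apply: lendoP => f /=; rewrite addrC. Qed.

Lemma lendo_add0 : left_id lendo_zero lendo_add.
Proof. by move=> p; apply: lendoP => f /=; rewrite add0r. Qed.

Lemma lendo_addN : left_inverse lendo_zero lendo_opp lendo_add.
Proof. by move=> p; apply: lendoP => f /=; rewrite addNr. Qed.

HB.instance Definition _ :=
  GRing.isZmodule.Build E lendo_addA lendo_addC lendo_add0 lendo_addN.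

Lemma lendo_mulA : associative lendo_mul.
Proof. by move=> p q r; apply: lendoP. Qed.

Lemma lendo_mul1 : left_id lendo_one lendo_mul.
Proof. by move=> p; apply: lendoP. Qed.

Lemma lendo_mulr1 : right_id lendo_one lendo_mul.
Proof. by move=> p; apply: lendoP. Qed.

Lemma lendo_mulDl : left_distributive lendo_mul +%R.
Proof. by move=> p q r; apply: lendoP. Qed.

Lemma lendo_mulDr : right_distributive lendo_mul +%R.
Proof. by move=> p q r; apply: lendoP => f /=; rewrite linearD. Qed.

Lemma lendo_one_neq0 : lendo_one != 0.
Proof.
apply/eqP => /(congr1 (fun p : E => p 1)) /eqP /=.
by rewrite (oner_eq0 L).
Qed.

HB.instance Definition _ := GRing.Zmodule_isNzRing.Build E lendo_mulA
  lendo_mul1 lendo_mulr1 lendo_mulDl lendo_mulDr lendo_one_neq0.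

Lemma lendo_scaleA a c p :
  lendo_scale a (lendo_scale c p) = lendo_scale (a * c) p.
Proof. by apply: lendoP => f /=; rewrite scalerA. Qed.

Lemma lendo_scale1 : left_id 1 lendo_scale.
Proof. by move=> p; apply: lendoP => f /=; rewrite scale1r. Qed.

Lemma lendo_scaleDr : right_distributive lendo_scale +%R.
Proof. by move=> a p q; apply: lendoP => f /=; rewrite scalerDr. Qed.

Lemma lendo_scaleDl p : {morph lendo_scale^~ p : a c / a + c}.
Proof. by move=> a c; apply: lendoP => f /=; rewrite scalerDl. Qed.

HB.instance Definition _ := GRing.Zmodule_isLmodule.Build F E
  lendo_scaleA lendo_scale1 lendo_scaleDr lendo_scaleDl.

Lemma lendo_scaleAl a p q : a *: (p * q) = (a *: p) * q.
Proof. by apply: lendoP. Qed.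

HB.instance Definition _ := GRing.Lmodule_isLalgebra.Build F E lendo_scaleAl.

Lemma lendo_scaleAr a p q : a *: (p * q) = p * (a *: q).
Proof. by apply: lendoP => f /=; rewrite linearZ. Qed.

HB.instance Definition _ := GRing.Lalgebra_isAlgebra.Build F E lendo_scaleAr.

Lemma lendoDE p q f : (p + q) f = p f + q f. Proof. by []. Qed.
Lemma lendoNE p f : (- p) f = - p f. Proof. by []. Qed.
Lemma lendoME p q f : (p * q) f = p (q f). Proof. by []. Qed.
Lemma lendoZE a p f : (a *: p) f = a *: p f. Proof. by []. Qed.

Lemma lendo_sumE (I : Type) (s : seq I) (P : pred I) (p : I -> E) f :
  (\sum_(i <- s | P i) p i) f = \sum_(i <- s | P i) p i f.
Proof. by elim/big_rec2: _ => //= i x y _ <-. Qed.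

Definition lmulby f g : L := f * g.

Lemma lmulby_is_linear f : linear (lmulby f).
Proof. by move=> a g h; rewrite /lmulby mulrDr scalerAr. Qed.

HB.instance Definition _ f :=
  GRing.isLinear.Build F L L *:%R (lmulby f) (lmulby_is_linear f).

Definition mulop f : E := lmulby f.
Definition partop (i : 'I_n) : E := lpartial i.

Lemma mulopE f g : mulop f g = f * g. Proof. by []. Qed.
Lemma partopE i f : partop i f = lpartial i f. Proof. by []. Qed.

Lemma mulop_is_linear : linear mulop.
Proof.
move=> a f g; apply: lendoP => h.
by rewrite lendoDE lendoZE !mulopE mulrDl scalerAl.
Qed.

HB.instance Definition _ :=
  GRing.isLinear.Build F L E *:%R mulop mulop_is_linear.

Lemma mulopM f g : mulop (f * g) = mulop f * mulop g.
Proof. by apply: lendoP => h; rewrite lendoME !mulopE mulrA. Qed.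

Lemma mulop1 : mulop 1 = 1.
Proof. by apply: lendoP => h; rewrite mulopE mul1r. Qed.

End Endomorphisms.

Section DifferentialOperators.
Variables (F : fieldType) (n : nat).
Local Notation L := (laurent F n).
Local Notation E := (lendo F n).

(* The unital F-subalgebra generated by the t_i, their inverses and the
   t_i d/dt_i. *)
Inductive is_diffop : E -> Prop :=
| is_diffop_t i : is_diffop (mulop (lmonom (delta_mx 0 i)))
| is_diffop_tV i : is_diffop (mulop (lmonom (- delta_mx 0 i)))
| is_diffop_partial i : is_diffop (partop F i)
| is_diffop_1 : is_diffop 1
| is_diffop_lin (a : F) p q :
    is_diffop p -> is_diffop q -> is_diffop (a *: p + q)
| is_diffop_mul p q : is_diffop p -> is_diffop q -> is_diffop (p * q).

Definition diffop_pred : {pred E} := fun p => `[< is_diffop p >].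

Lemma diffopP p : reflect (is_diffop p) (p \in diffop_pred).
Proof. exact: asboolP. Qed.

Lemma diffop_subalg_closed : GRing.subalg_closed diffop_pred.
Proof.
split=> [|a p q|p q]; first exact/diffopP/is_diffop_1.
- by move=> /diffopP dp /diffopP dq; apply/diffopP/is_diffop_lin.
- by move=> /diffopP dp /diffopP dq; apply/diffopP/is_diffop_mul.
Qed.

HB.instance Definition _ :=
  GRing.isSubalgClosed.Build F E diffop_pred diffop_subalg_closed.

Record diffop := Diffop { diffop_val : E; _ : diffop_val \in diffop_pred }.

HB.instance Definition _ := [isSub for diffop_val].
HB.instance Definition _ := [Choice of diffop by <:].
HB.instance Definition _ := [SubChoice_isSubAlgebra of diffop by <:].

Lemma diffop_monom k : is_diffop (mulop (lmonom k)).
Proof.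
apply: (@lmonom_ind F n (fun f => is_diffop (mulop f))) => [|f g df dg|i|i].
- by rewrite mulop1; apply: is_diffop_1.
- by rewrite mulopM; apply: is_diffop_mul.
- exact: is_diffop_t.
- exact: is_diffop_tV.
Qed.

Lemma diffop_mulop f : is_diffop (mulop f).
Proof.
apply/diffopP; elim/laurent_ind: f => [a k||f g df dg].
- by rewrite linearZ; apply/rpredZ/diffopP/diffop_monom.
- by rewrite linear0 rpred0.
- by rewrite linearD rpredD.
Qed.

Lemma mulop_in f : mulop f \in diffop_pred.
Proof. exact/diffopP/diffop_mulop. Qed.

Lemma partop_in i : partop F i \in diffop_pred.
Proof. exact/diffopP/is_diffop_partial. Qed.

(* t^k and t_i d/dt_i as elements of the algebra of differential operators. *)
Definition tpow (k : 'rV[int]_n) : diffop := Diffop (mulop_in (lmonom k)).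
Definition tpartial (i : 'I_n) : diffop := Diffop (partop_in i).

End DifferentialOperators.

Section WittAlgebra.
Variables (F : fieldType) (n : nat).
Local Notation L := (laurent F n).
Local Notation E := (lendo F n).

Definition is_derivation (p : E) :=
  forall f g : L, p (f * g) = p f * g + f * p g.

Definition witt_pred : {pred E} := fun p => `[< is_derivation p >].

Lemma wittP p : reflect (is_derivation p) (p \in witt_pred).
Proof. exact: asboolP. Qed.

Lemma witt_submod_closed : GRing.submod_closed witt_pred.
Proof.
split=> [|a p q]; first by apply/wittP => f g; rewrite mul0r mulr0 addr0.
move=> /wittP dp /wittP dq; apply/wittP => f g.
rewrite !lendoDE !lendoZE dp dq !mulrDl !mulrDr !scalerDr scalerAl scalerAr.
by rewrite addrACA.
Qed.

HB.instance Definition _ :=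
  GRing.isSubmodClosed.Build F E witt_pred witt_submod_closed.

Record witt := Witt { witt_val : E; _ : witt_val \in witt_pred }.

HB.instance Definition _ := [isSub for witt_val].
HB.instance Definition _ := [Choice of witt by <:].
HB.instance Definition _ := [SubChoice_isSubLmodule of witt by <:].

Implicit Types (X Y Z : witt) (f g : L) (k r s : 'rV[int]_n) (u v : 'rV[F]_n).

Lemma wittM X f g : witt_val X (f * g) = witt_val X f * g + f * witt_val X g.
Proof. by case: X => p /= /wittP. Qed.

Lemma witt_inj X Y : (forall f, witt_val X f = witt_val Y f) -> X = Y.
Proof. by move=> eXY; apply/val_inj/lendoP. Qed.

Lemma bracket_subproof X Y :
  witt_val X * witt_val Y - witt_val Y * witt_val X \in witt_pred.
Proof.
apply/wittP => f g; rewrite !lendoDE !lendoNE !lendoME !wittM !linearD /= !wittM.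
ring.
Qed.

Definition bracket X Y : witt := Witt (bracket_subproof X Y).

Lemma bracketE X Y f :
  witt_val (bracket X Y) f =
  witt_val X (witt_val Y f) - witt_val Y (witt_val X f).
Proof. by []. Qed.

Lemma wittDE X Y f : witt_val (X + Y) f = witt_val X f + witt_val Y f.
Proof. by []. Qed.

Lemma wittZE a X f : witt_val (a *: X) f = a *: witt_val X f.
Proof. by []. Qed.

Lemma witt_valD X f g : witt_val X (f + g) = witt_val X f + witt_val X g.
Proof. exact: linearD. Qed.

Lemma witt_valZ X a f : witt_val X (a *: f) = a *: witt_val X f.
Proof. exact: linearZ. Qed.

(* D(u, k) = t^k \sum_i u_i t_i d/dt_i. *)
Definition D_op u k : E := mulop (lmonom k) * \sum_i u 0 i *: partop F i.

Lemma D_opE u k f : D_op u k f = lmonom k * \sum_i u 0 i *: lpartial i f.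
Proof.
by rewrite lendoME mulopE lendo_sumE; congr (_ * _); apply: eq_bigr.
Qed.

Lemma D_subproof u k : D_op u k \in witt_pred.
Proof.
apply/wittP => f g; rewrite !D_opE.
have -> : \sum_i u 0 i *: lpartial i (f * g) =
    (\sum_i u 0 i *: lpartial i f) * g + f * \sum_i u 0 i *: lpartial i g.
  rewrite mulr_suml mulr_sumr -big_split; apply: eq_bigr => i _ /=.
  by rewrite lpartialM scalerDr scalerAl scalerAr.
ring.
Qed.

Definition D u k : witt := Witt (D_subproof u k).

Lemma DE u k f :
  witt_val (D u k) f = lmonom k * \sum_i u 0 i *: lpartial i f.
Proof. exact: D_opE. Qed.

(* The coefficient f_i in X = \sum_i f_i t_i d/dt_i. *)
Definition wcoef (i : 'I_n) X : L :=
  witt_val X (lmonom (delta_mx 0 i)) * lmonom (- delta_mx 0 i).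

Lemma wcoef_is_linear i : linear (wcoef i).
Proof.
by move=> a X Y; rewrite /wcoef wittDE wittZE mulrDl scalerAl.
Qed.

HB.instance Definition _ i :=
  GRing.isLinear.Build F witt L *:%R (wcoef i) (wcoef_is_linear i).

Lemma der1 (p : E) : is_derivation p -> p 1 = 0.
Proof.
move=> dp; have := dp 1 1; rewrite !mulr1 mul1r => /eqP.
by rewrite -subr_eq0 opprD addrA subrr add0r oppr_eq0 => /eqP.
Qed.

Lemma der_ext (p q : E) : is_derivation p -> is_derivation q ->
  (forall i, p (lmonom (delta_mx 0 i)) = q (lmonom (delta_mx 0 i))) -> p = q.
Proof.
move=> dp dq epq; apply: lendoP => f; elim/laurent_ind: f => [a k||f g ef eg].
- rewrite !linearZ /=; congr (_ *: _).
  apply: (@lmonom_ind F n (fun f => p f = q f)) => [|f g ef eg|//|i].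
  + by rewrite !der1.
  + by rewrite dp dq ef eg.
  + have iK : lmonom (- delta_mx 0 i) * lmonom (delta_mx 0 i) = 1 :> L.
      by rewrite mulrC lmonomK.
    have /(congr1 (fun f : L => lmonom (- delta_mx 0 i) * f)) :
        p (lmonom (delta_mx 0 i) * lmonom (- delta_mx 0 i)) =
        q (lmonom (delta_mx 0 i) * lmonom (- delta_mx 0 i)).
      by rewrite lmonomK !der1.
    rewrite dp dq epq !mulrDr => /addrI.
    by rewrite !mulrA iK !mul1r.
- by rewrite !linear0.
- by rewrite !linearD ef eg.
Qed.

Lemma wittE X : witt_val X = \sum_i mulop (wcoef i X) * partop F i.
Proof.
apply: der_ext => [||i]; first exact: wittM.
  move=> f g; rewrite !lendo_sumE mulr_suml mulr_sumr -big_split.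
  apply: eq_bigr => i _; rewrite !lendoME !mulopE !partopE lpartialM /=; ring.
rewrite lendo_sumE (bigD1 i) // big1 ?addr0 => [|j /andP[_ ji]].
  rewrite lendoME mulopE partopE lpartial_monom mxE !eqxx scale1r /wcoef.
  rewrite -mulrA [X in _ * X]mulrC lmonomK mulr1; exact/esym/addr0.
by rewrite lendoME mulopE partopE lpartial_monom mxE eqxx (negPf ji) scale0r mulr0.
Qed.

Lemma wittEf X f : witt_val X f = \sum_i wcoef i X * lpartial i f.
Proof.
by rewrite wittE lendo_sumE; apply: eq_bigr.
Qed.

Lemma wcoef_D u k i : wcoef i (D u k) = u 0 i *: lmonom k.
Proof.
rewrite /wcoef DE (bigD1 i) //= big1 ?addr0 => [|j ji].
  rewrite lpartial_monom mxE !eqxx scale1r -scalerAr -scalerAl -mulrA lmonomK.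
  by rewrite mulr1.
by rewrite lpartial_monom mxE eqxx (negPf ji) scale0r scaler0.
Qed.

Lemma witt_coefP X Y : (forall i, wcoef i X = wcoef i Y) -> X = Y.
Proof.
move=> eXY; apply: witt_inj => f; rewrite !wittEf.
by apply: eq_bigr => i _; rewrite eXY.
Qed.

Lemma witt_span X :
  exists s : seq ('rV[F]_n * 'rV[int]_n), X = \sum_(d <- s) D d.1 d.2.
Proof.
have -> : X = \sum_i \sum_(k <- msupp (wcoef i X))
    D ((wcoef i X)@_k *: delta_mx 0 i) k.
  apply: witt_coefP => j; rewrite (linear_sum (wcoef j)) (bigD1 j) //=.
  rewrite [X in _ + X]big1 ?addr0 => [|i ij].
    rewrite linear_sum /= {1}(laurentE (wcoef j X)); apply: eq_bigr => k _.
    by rewrite wcoef_D !mxE !eqxx mulr1.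
  rewrite linear_sum /= big1 // => k _.
  by rewrite wcoef_D !mxE eq_sym (negPf ij) andbF mulr0 scale0r.
elim/big_rec: _ => [|i Z _ [s ->]]; first by exists [::]; rewrite big_nil.
elim/big_rec: _ => [|k W _ [s' e]]; first by exists s; rewrite add0r.
by exists (((wcoef i X)@_k *: delta_mx 0 i, k) :: s'); rewrite big_cons /= -e addrA.
Qed.

Definition dotmul u v : F := \sum_i u 0 i * v 0 i.

(* The integer vector k, seen in F^n. *)
Definition intv k : 'rV[F]_n := map_mx intr k.

Lemma lmonom_D u k r :
  witt_val (D u k) (lmonom r) = dotmul u (intv r) *: lmonom (k + r).
Proof.
rewrite DE -lmonomM scalerAr scaler_suml; congr (_ * _).
by apply: eq_bigr => i _; rewrite lpartial_monom scalerA mxE.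
Qed.

(* The divergence of X with respect to the derivations t_i d/dt_i. *)
Definition wdiv X : L := \sum_i lpartial i (wcoef i X).

Lemma wdiv_is_linear : linear wdiv.
Proof.
move=> a X Y; rewrite /wdiv scaler_sumr -big_split; apply: eq_bigr => i _ /=.
by rewrite linearP /= linearP.
Qed.

HB.instance Definition _ :=
  GRing.isLinear.Build F witt L *:%R wdiv wdiv_is_linear.

Lemma wdiv_D u k : wdiv (D u k) = dotmul u (intv k) *: lmonom k.
Proof.
rewrite /wdiv scaler_suml; apply: eq_bigr => i _.
by rewrite wcoef_D linearZ /= lpartial_monom scalerA mxE.
Qed.

Lemma wcoef_bracket X Y i :
  wcoef i (bracket X Y) = witt_val X (wcoef i Y) - witt_val Y (wcoef i X).
Proof.
rewrite /wcoef bracketE !wittM.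
set t := lmonom (delta_mx 0 i); set t' := lmonom (- delta_mx 0 i).
have tK : t * t' = 1 by exact: lmonomK.
have dV Z : witt_val Z t' = - (t' * t' * witt_val Z t).
  have e0 : witt_val Z t * t' + t * witt_val Z t' = 0.
    by rewrite -wittM tK (der1 (wittM Z)).
  transitivity (t' * (witt_val Z t * t' + t * witt_val Z t')
      - t' * t' * witt_val Z t + (1 - t * t') * witt_val Z t'); first ring.
  by rewrite e0 tK subrr mulr0 mul0r add0r addr0.
rewrite !dV; ring.
Qed.

Lemma bracket_D u r v s :
  bracket (D u r) (D v s) =
  D (dotmul u (intv s) *: v - dotmul v (intv r) *: u) (r + s).
Proof.
apply: witt_coefP => i; rewrite wcoef_bracket !wcoef_D !witt_valZ !lmonom_D.
rewrite !scalerA [s + r]addrC -scalerBl !mxE; congr (_ *: _).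
by rewrite [v 0 i * _]mulrC [u 0 i * _]mulrC.
Qed.

Lemma wdiv_bracket X Y :
  wdiv (bracket X Y) = witt_val X (wdiv Y) - witt_val Y (wdiv X).
Proof.
have H Z W : witt_val Z (wdiv W) = \sum_i lpartial i (witt_val Z (wcoef i W))
    - \sum_i \sum_j lpartial i (wcoef j Z) * lpartial j (wcoef i W).
  rewrite linear_sum -sumrB /=; apply: eq_bigr => i _.
  rewrite !wittEf linear_sum -sumrB /=; apply: eq_bigr => j _.
  by rewrite lpartialM lpartialC [X in X - _]addrC addrK.
have -> : wdiv (bracket X Y) = \sum_i lpartial i (witt_val X (wcoef i Y))
    - \sum_i lpartial i (witt_val Y (wcoef i X)).
  by rewrite -sumrB; apply: eq_bigr => i _; rewrite wcoef_bracket linearB.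
rewrite !H [in X in _ - (_ - X)]exchange_big /=.
under [in X in _ - (_ - X)]eq_bigr do under eq_bigr do rewrite mulrC.
by rewrite opprB addrA subrK.
Qed.

End WittAlgebra.

Section Modules.
Variables (F : fieldType) (n : nat).
Local Notation L := (laurent F n).
Local Notation K := (diffop F n).
Local Notation W := (witt F n).
Implicit Types (X Y : W) (u : 'rV[F]_n) (k : 'rV[int]_n) (b : F).

Lemma witt_diffop X : witt_val X \in @diffop_pred F n.
Proof.
by rewrite wittE; apply: rpred_sum => i _; rewrite rpredM ?mulop_in ?partop_in.
Qed.

(* The differential operator X + b div(X), where div(D(u, k)) = (u|k) t^k; see
   twist_D. *)
Definition twist b X : K :=
  Diffop (witt_diffop X) + b *: Diffop (mulop_in (wdiv X)).

Lemma twist_val b X : diffop_val (twist b X) = witt_val X + b *: mulop (wdiv X).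
Proof. by []. Qed.

Lemma twistE b X f :
  diffop_val (twist b X) f = witt_val X f + b *: (wdiv X * f).
Proof. by []. Qed.

Lemma diffop_inj (p q : K) : diffop_val p = diffop_val q -> p = q.
Proof. exact: val_inj. Qed.

Lemma twist_is_linear b : linear (twist b).
Proof.
move=> a X Y; apply: diffop_inj.
rewrite [RHS](_ : _ = a *: diffop_val (twist b X) + diffop_val (twist b Y)) //.
rewrite !twist_val [wdiv _]linearP [mulop _]linearP.
rewrite [LHS](_ : _ = a *: witt_val X + witt_val Y +
  b *: (a *: mulop (wdiv X) + mulop (wdiv Y))) //.
by rewrite !scalerDr !scalerA [b * a]mulrC addrACA.
Qed.

HB.instance Definition _ b :=
  GRing.isLinear.Build F W K *:%R (twist b) (twist_is_linear b).

Lemma twist_bracket b X Y :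
  twist b (bracket X Y) = twist b X * twist b Y - twist b Y * twist b X.
Proof.
apply: diffop_inj; apply: lendoP => f.
rewrite [RHS](_ : _ = diffop_val (twist b X) (diffop_val (twist b Y) f) -
  diffop_val (twist b Y) (diffop_val (twist b X) f)) //.
rewrite 5!twistE bracketE wdiv_bracket 2!witt_valD 2!witt_valZ 2!wittM.
have [c bE] : exists c : L, forall g : L, b *: g = c * g.
  by exists b%:A => g; rewrite mulr_algl.
rewrite !bE; ring.
Qed.

Lemma twist_D b u k :
  twist b (D u k) = tpow F k * (\sum_i u 0 i *: tpartial F i)
                    + (b * dotmul u (intv F k)) *: tpow F k.
Proof.
apply: diffop_inj; rewrite twist_val wdiv_D linearZ scalerA.
rewrite [RHS](_ : _ = D_op u k +
  (b * dotmul u (intv F k)) *: mulop (lmonom k)) //.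
congr (_ * _ + _).
rewrite (raddf_sum (val : K -> lendo F n)); exact: eq_bigr.
Qed.

(* A module over the algebra of differential operators, as an F-vector space. *)
Definition restrict (A : lmodType K) : Type := A.

Section Restrict.
Variable A : lmodType K.

HB.instance Definition _ := GRing.Zmodule.copy (restrict A) A.

Definition restrict_scale (a : F) (v : restrict A) : restrict A :=
  (a%:A : K) *: (v : A).

Lemma restrict_scaleA a c v :
  restrict_scale a (restrict_scale c v) = restrict_scale (a * c) v.
Proof. by rewrite /restrict_scale scalerA mulr_algl scalerA. Qed.

Lemma restrict_scale1 : left_id 1 restrict_scale.
Proof. by move=> v; rewrite /restrict_scale !scale1r. Qed.

Lemma restrict_scaleDr : right_distributive restrict_scale +%R.
Proof. by move=> a v w; apply: scalerDr. Qed.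

Lemma restrict_scaleDl v : {morph restrict_scale^~ v : a c / a + c}.
Proof. by move=> a c; rewrite /restrict_scale scalerDl; apply: scalerDl. Qed.

HB.instance Definition _ := GRing.Zmodule_isLmodule.Build F (restrict A)
  restrict_scaleA restrict_scale1 restrict_scaleDr restrict_scaleDl.

End Restrict.

Record wittModule := WittModule {
  wcarrier :> lmodType F;
  wact : W -> wcarrier -> wcarrier;
  wact_linear : forall X, linear (wact X);
  wact_linearl : forall v, linear (wact^~ v);
  wact_bracket : forall X Y v,
    wact (bracket X Y) v = wact X (wact Y v) - wact Y (wact X v)
}.

Definition witt_iso (M N : wittModule) :=
  exists f : {linear M -> N},
    bijective f /\ forall X v, f (wact X v) = wact X (f v).

Section Twist.
Variables (A : lmodType K) (b : F).

Definition twisted_act X (v : restrict A) : restrict A :=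
  twist b X *: (v : A).

Lemma twisted_act_linear X : linear (twisted_act X).
Proof.
move=> a v w; rewrite /twisted_act scalerDr; congr (_ + _).
rewrite -[a *: v]/(restrict_scale a v) -[RHS]/(restrict_scale a _).
by rewrite /restrict_scale !scalerA mulr_algl mulr_algr.
Qed.

Lemma twisted_act_linearl v : linear (twisted_act^~ v).
Proof.
move=> a X Y; rewrite /twisted_act linearP scalerDl; congr (_ + _).
rewrite -[RHS]/(restrict_scale a _).
by rewrite /restrict_scale scalerA mulr_algl.
Qed.

Lemma twisted_act_bracket X Y v :
  twisted_act (bracket X Y) v =
  twisted_act X (twisted_act Y v) - twisted_act Y (twisted_act X v).
Proof. by rewrite /twisted_act twist_bracket scalerBl !scalerA. Qed.

(* The module A_b.  By witt_span, the formula twisted_D below determines the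
   action. *)
Definition twisted : wittModule :=
  WittModule twisted_act_linear twisted_act_linearl twisted_act_bracket.

Lemma twisted_D u k (v : A) :
  wact (D u k : W) (v : twisted) =
  (tpow F k * (\sum_i u 0 i *: tpartial F i)) *: v
    + ((b * dotmul u (intv F k)) *: tpow F k) *: v.
Proof. by rewrite -scalerDl -twist_D. Qed.

End Twist.

End Modules.

Section RingModules.
Variable K : pzRingType.

(* A subset is given by a boolean predicate; under the classical axioms used
   here this is no restriction. *)
Definition irreducible_module (A : lmodType K) :=
  (exists v : A, v != 0) /\
  forall S : {pred A}, GRing.submod_closed S ->
    S =i pred1 0 \/ S =i predT.

Definition module_iso (A B : lmodType K) :=
  exists f : {linear A -> B}, bijective f.

End RingModules.

(* Main.v *)
From Pilot Require Import Defs.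
From mathcomp Require Import all_boot all_order all_algebra.
From HB Require Import structures.
From mathcomp Require Import boolp reals complex.

Set Implicit Arguments.
Unset Strict Implicit.
Unset Printing Implicit Defensive.

Import GRing.Theory Num.Theory.
Local Open Scope ring_scope.

(** A K_n-linear bijection also intertwines the twisted actions, so the content
    is the converse: a bijection phi : A -> A' that intertwines the actions with
    parameters b and b' forces b = b' and is itself K_n-linear.

    Write d_u = sum_i u_i d_i, so that D(u, k) acts on A_b by
    t^k (d_u + b (u|k)).  Taking k = 0 shows that phi commutes with every d_u.

    Equality of the parameters ([tpartial_phi_eq0]).  For i != j, the product
    of the operators of D(e_i, e_i) and D(e_j, -e_i) is
      t_i (d_i + b) t_i^-1 d_j = (d_i + b - 1) d_j,
    in which only the scalar b - 1 depends on the parameter.  As phi intertwines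
    these products and commutes with d_i and d_j, one gets
    (b - b') d_j A' = 0.  But d_j = 0 on A' contradicts
    [d_j, t_j] = t_j as soon as A' != 0 ([tpartial_eq0]).

    Linearity ([twist_intertwiner_linear]).  Assume b = b', and measure the
    failure of linearity by the defect
      delta_r = phi t^r - t^r phi,
    which obeys delta_(r+s) = delta_r t^s + t^r delta_s.  The intertwining
    relation says that delta_r behaves like an operator of a definite weight on
    both sides:
      d_u delta_r = (1 - b) (u|r) delta_r,    delta_r d_u = - b (u|r) delta_r.
    If r != 0 then n >= 2 yields u and s with (u|r) = 0 and (u|s) != 0.
    Comparing the weights of the three terms of the cocycle relation, on the
    left or on the right, gives (1 - b) (u|s) delta_r t^s = 0 and
    b (u|s) t^s delta_r = 0.  One of b and 1 - b is nonzero, so delta_r = 0;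
    since the t^r and the d_i generate K_n, phi is K_n-linear. *)

(** * Relations in the algebra of differential operators *)

Section DiffopRelations.
Variables (F : fieldType) (n : nat).
Local Notation K := (diffop F n).
Local Notation dot u k := (dotmul u (intv F k)).
Implicit Types (u v : 'rV[F]_n) (k l : 'rV[int]_n) (a b : F) (p q : K).

Lemma dotmul_deltal i k : dot (delta_mx 0 i) k = (k 0 i)%:~R.
Proof.
rewrite /dotmul (bigD1 i) //= big1 => [|j ji]; last first.
  by rewrite mxE (negPf ji) andbF mul0r.
by rewrite !mxE !eqxx mul1r addr0.
Qed.

Lemma dotmulDr u k l : dot u (k + l) = dot u k + dot u l.
Proof.
rewrite /dotmul -big_split; apply: eq_bigr => i _ /=.
by rewrite !mxE rmorphD mulrDr.
Qed.

Lemma dotmulBl u v k : dot (u - v) k = dot u k - dot v k.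
Proof.
rewrite /dotmul -sumrB; apply: eq_bigr => i _ /=.
by rewrite !mxE mulrBl.
Qed.

Lemma dotmulZl a u k : dot (a *: u) k = a * dot u k.
Proof.
by rewrite /dotmul mulr_sumr; apply: eq_bigr => i _; rewrite mxE mulrA.
Qed.

Definition dir u : K := \sum_i u 0 i *: tpartial F i.

Lemma dir_delta i : dir (delta_mx 0 i) = tpartial F i.
Proof.
rewrite /dir (bigD1 i) //= big1 => [|j ji].
  by rewrite mxE !eqxx scale1r addr0.
by rewrite mxE (negPf ji) andbF scale0r.
Qed.

Lemma tpowM k l : tpow F k * tpow F l = tpow F (k + l).
Proof.
by apply: diffop_inj; rewrite -[LHS]/(mulop _ * mulop _) -mulopM lmonomM.
Qed.

Lemma tpow0 : tpow F (0 : 'rV_n) = 1.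
Proof. by apply: diffop_inj; rewrite /= lmonom0 mulop1. Qed.

Lemma dir_val u : diffop_val (dir u) = \sum_i u 0 i *: partop F i.
Proof.
apply: etrans (raddf_sum (val : K -> lendo F n) _ _ _) _; exact: eq_bigr.
Qed.

Lemma dir_tpow u k :
  dir u * tpow F k = tpow F k * (dir u + (dot u k)%:A).
Proof.
apply: diffop_inj; apply: lendoP => f.
rewrite [LHS](_ : _ = diffop_val (dir u) (lmonom k * f)) //.
rewrite [RHS](_ : _ = lmonom k *
   (diffop_val (dir u) f + dot u k *: f)) //.
rewrite dir_val !lendo_sumE /dotmul scaler_suml -big_split mulr_sumr /=.
apply: eq_bigr => i _.
rewrite lpartialM lpartial_monom mxE scalerDr mulrDr addrC -!scalerAr.
by rewrite -scalerAl scalerA.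
Qed.

Lemma tpow_dirC u k : dot u k = 0 -> dir u * tpow F k = tpow F k * dir u.
Proof. by move=> uk; rewrite dir_tpow uk scale0r addr0. Qed.

Lemma diffop_ind (P : K -> Prop) :
  (forall k, P (tpow F k)) -> (forall i, P (tpartial F i)) ->
  (forall a p q, P p -> P q -> P (a *: p + q)) ->
  (forall p q, P p -> P q -> P (p * q)) -> forall p, P p.
Proof.
move=> Pt Pd PL PM [e he]; have /diffopP de := he.
elim: de he => {e} [i|i|i||a p q dp IHp dq IHq|p q dp IHp dq IHq] he.
- by rewrite (_ : Diffop he = tpow F (delta_mx 0 i)) //; apply: diffop_inj.
- by rewrite (_ : Diffop he = tpow F (- delta_mx 0 i)) //; apply: diffop_inj.
- by rewrite (_ : Diffop he = tpartial F i) //; apply: diffop_inj.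
- by rewrite (_ : Diffop he = tpow F 0) // tpow0; apply: diffop_inj.
- have [/diffopP hp /diffopP hq] := (dp, dq).
  rewrite (_ : Diffop he = a *: Diffop hp + Diffop hq); last exact: diffop_inj.
  exact: PL.
- have [/diffopP hp /diffopP hq] := (dp, dq).
  rewrite (_ : Diffop he = Diffop hp * Diffop hq); last exact: diffop_inj.
  exact: PM.
Qed.

Lemma tpow_eq0 k (A : lmodType K) (v : A) : tpow F k *: v = 0 -> v = 0.
Proof.
move=> /(congr1 ( *:%R (tpow F (- k)))).
by rewrite scaler0 scalerA tpowM addNr tpow0 scale1r.
Qed.

Lemma scalar_eq0 a (A : lmodType K) (v : A) : a != 0 -> a%:A *: v = 0 -> v = 0.
Proof.
move=> a0 /(congr1 ( *:%R (a^-1%:A : K))).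
by rewrite scaler0 scalerA mulr_algl scalerA mulVf // !scale1r.
Qed.

(** The commutator of t_j d/dt_j with t_j is t_j, which is invertible. *)
Lemma tpartial_eq0 (A : lmodType K) (j : 'I_n) (v : A) :
  (forall w : A, tpartial F j *: w = 0) -> v = 0.
Proof.
move=> dA; apply: (@tpow_eq0 (delta_mx 0 j)).
have := congr1 ( *:%R^~ v) (dir_tpow (delta_mx 0 j) (delta_mx 0 j)).
rewrite dir_delta dotmul_deltal mxE !eqxx /= -!scalerA dA scalerDl dA add0r.
by rewrite !scale1r.
Qed.

(** The operator by which D(u, k) acts on A_b, in the factored form that makes
    products easy to normalise. *)
Definition twist_op b u k : K := tpow F k * (dir u + (b * dot u k)%:A).

Lemma twist_opE b u k : twist b (D u k) = twist_op b u k.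
Proof. by rewrite twist_D /twist_op mulrDr mulr_algr. Qed.

Lemma twist_op0 b u : twist_op b u 0 = dir u.
Proof.
rewrite /twist_op tpow0 mul1r /dotmul big1 ?mulr0 ?scale0r ?addr0 // => i _.
by rewrite !mxE mulr0.
Qed.

(** The total degree in t vanishes and e_j is orthogonal to e_i, so the product
    is a polynomial in d_i and d_j in which the parameter survives only
    as a scalar. *)
Lemma twist_opM_opp b (i j : 'I_n) : j != i ->
  twist_op b (delta_mx 0 i) (delta_mx 0 i) *
  twist_op b (delta_mx 0 j) (- delta_mx 0 i) =
  (tpartial F i + (b - 1)%:A) * tpartial F j.
Proof.
move=> ji; have tiV : ((- delta_mx 0 i : 'rV[int]_n) 0 i)%:~R = -1 :> F.
  by rewrite !mxE !eqxx.
rewrite /twist_op !dotmul_deltal !mxE !eqxx (negPf ji) /=.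
rewrite oppr0 mulr0 mulr1 scale0r addr0 !dir_delta mulrA; congr (_ * _).
rewrite -mulrA mulrDl -{1}dir_delta dir_tpow dotmul_deltal tiV.
rewrite mulr_algl -(mulr_algr b) -mulrDr mulrA tpowM subrr tpow0 mul1r.
by rewrite dir_delta -addrA -scalerDl (addrC (-1) b).
Qed.

Lemma exists_other_ord (i : 'I_n) : (2 <= n)%N -> exists j, j != i.
Proof.
move=> n2; have [i0|i0] := posnP i.
  by exists (Ordinal n2); rewrite -val_eqE /= i0.
by exists (Ordinal (ltnW n2)); rewrite -val_eqE /= neq_ltn i0.
Qed.

End DiffopRelations.

Lemma exists_orthogonal (F : numFieldType) (n : nat) (r : 'rV[int]_n) :
  (2 <= n)%N -> r != 0 -> exists (u : 'rV[F]_n) (s : 'rV[int]_n),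
    dotmul u (intv F r) = 0 /\ dotmul u (intv F s) != 0.
Proof.
move=> n2 r0.
have [i ri] : exists i, r 0 i != 0.
  apply/existsP; apply: contraNT r0 => /existsPn r0.
  by apply/eqP/rowP => i; rewrite mxE; apply/eqP; have := r0 i; rewrite negbK.
have [j ji] := exists_other_ord i n2.
(* The rotation of r in the plane of the coordinates i and j. *)
exists ((r 0 j)%:~R *: delta_mx 0 i - (r 0 i)%:~R *: delta_mx 0 j).
exists (delta_mx 0 j); rewrite !dotmulBl !dotmulZl !dotmul_deltal mulrC subrr.
split=> //; rewrite !mxE !eqxx (eq_sym i) (negPf ji) mulr0 mulr1 sub0r oppr_eq0.
by rewrite intr_eq0.
Qed.

(** * Maps that intertwine twisted actions *)

Section Intertwiners.
Variables (F : numFieldType) (n : nat).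
Local Notation K := (diffop F n).
Local Notation dot u k := (dotmul u (intv F k)).
Implicit Types (u : 'rV[F]_n) (k r s : 'rV[int]_n) (a : F) (p q : K).

Variables (A A' : lmodType K) (phi : A -> A').
Hypothesis phi_linear : linear (phi : Defs.restrict A -> Defs.restrict A').

Lemma phi_lin a v w : phi (a%:A *: v + w) = a%:A *: phi v + phi w.
Proof. exact: phi_linear. Qed.

Lemma phiD v w : phi (v + w) = phi v + phi w.
Proof. by have := phi_lin 1 v w; rewrite !scale1r. Qed.

Lemma phi0 : phi 0 = 0.
Proof. by apply: (addrI (phi 0)); rewrite -phiD !addr0. Qed.

Lemma phiZ a v : phi (a%:A *: v) = a%:A *: phi v.
Proof. by have := phi_lin a v 0; rewrite phi0 !addr0. Qed.

Hypothesis n_ge2 : (2 <= n)%N.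

Section DistinctParameters.
Variables b b' : F.
Hypothesis phi_twist : forall u k v,
  phi (twist_op b u k *: v) = twist_op b' u k *: phi v.

(** Both sides of [twist_opM_opp] are intertwined, and the difference of the
    two resulting relations is (b - b') d_j phi = 0. *)
Lemma tpartial_phi_eq0 (j : 'I_n) v : b != b' -> tpartial F j *: phi v = 0.
Proof.
move=> bb'; have [i ij] := exists_other_ord j n_ge2.
have phi_t (k : 'I_n) w : phi (tpartial F k *: w) = tpartial F k *: phi w.
  by have := phi_twist (delta_mx 0 k) 0 w; rewrite !twist_op0 dir_delta.
have : phi ((tpartial F i + (b - 1)%:A) * tpartial F j *: v) =
    (tpartial F i + (b' - 1)%:A) * tpartial F j *: phi v.
  by rewrite -!twist_opM_opp 1?eq_sym // -scalerA !phi_twist scalerA.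
rewrite -!scalerA [X in phi X]scalerDl [RHS]scalerDl phiD phiZ !phi_t.
move=> /addrI /eqP.
rewrite -subr_eq0 -scalerBl -scalerBl => /eqP; apply: scalar_eq0.
by rewrite opprB addrA subrK subr_eq0.
Qed.

End DistinctParameters.

Definition defect p v := phi (p *: v) - p *: phi v.

Lemma defectD p q v : defect (p + q) v = defect p v + defect q v.
Proof. by rewrite /defect !scalerDl phiD opprD addrACA. Qed.

Lemma defectZ a p v : defect (a *: p) v = a%:A *: defect p v.
Proof. by rewrite /defect -(mulr_algl a p) -!scalerA phiZ scalerBr. Qed.

Lemma defectM p q v : defect (p * q) v = defect p (q *: v) + p *: defect q v.
Proof. by rewrite /defect scalerBr !scalerA addrA subrK. Qed.

Lemma defect1 v : defect 1 v = 0.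
Proof. by rewrite /defect !scale1r subrr. Qed.

Lemma defect_tpowD r s v :
  defect (tpow F (r + s)) v =
  defect (tpow F r) (tpow F s *: v) + tpow F r *: defect (tpow F s) v.
Proof. by rewrite -tpowM defectM. Qed.

Section EqualParameters.
Variables b : F.
Hypothesis phi_twist : forall u k v,
  phi (twist_op b u k *: v) = twist_op b u k *: phi v.

Lemma defect_twist u k v : defect (twist_op b u k) v = 0.
Proof. by rewrite /defect phi_twist subrr. Qed.

Lemma defect_dir u v : defect (dir u) v = 0.
Proof. by rewrite -(twist_op0 b) defect_twist. Qed.

Lemma defect_tpow_dir u k v :
  defect (tpow F k * dir u) v = (- (b * dot u k))%:A *: defect (tpow F k) v.
Proof.
have := defect_twist u k v.
rewrite /twist_op mulrDr mulr_algr defectD defectZ !scaleNr => /eqP.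
by rewrite addr_eq0 => /eqP.
Qed.

(** Moving d_u from the left of t^k to its right adds (u|k) to the weight
    - b (u|k) of [defect_tpow_dirR]. *)
Lemma defect_tpow_dirL u k v :
  dir u *: defect (tpow F k) v = ((1 - b) * dot u k)%:A *: defect (tpow F k) v.
Proof.
have -> : dir u *: defect (tpow F k) v = defect (dir u * tpow F k) v.
  by rewrite defectM defect_dir add0r.
rewrite dir_tpow mulrDr mulr_algr defectD defectZ defect_tpow_dir.
by rewrite -scalerDl -scalerDl mulrBl mul1r addrC.
Qed.

Lemma defect_tpow_dirR u k v :
  defect (tpow F k) (dir u *: v) = (- (b * dot u k))%:A *: defect (tpow F k) v.
Proof. by rewrite -defect_tpow_dir defectM defect_dir scaler0 addr0. Qed.

(** In delta_(r+s) = delta_r t^s + t^r delta_s, the terms delta_(r+s) and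
    t^r delta_s have weight (1 - b) (u|s) under d_u on the left, whereas
    delta_r t^s has weight 0. *)
Lemma defect_tpow_neq1 u r s v : b != 1 -> dot u r = 0 -> dot u s != 0 ->
  defect (tpow F r) (tpow F s *: v) = 0.
Proof.
move=> b1 ur us; set c := (1 - b) * dot u s.
have c0 : c != 0 by rewrite mulf_neq0 // subr_eq0 eq_sym.
have dir_s : dir u *: (tpow F r *: defect (tpow F s) v) =
    c%:A *: (tpow F r *: defect (tpow F s) v).
  rewrite scalerA tpow_dirC // -scalerA defect_tpow_dirL !scalerA.
  by rewrite mulr_algl mulr_algr.
have : dir u *: defect (tpow F (r + s)) v = c%:A *: defect (tpow F (r + s)) v.
  by rewrite defect_tpow_dirL dotmulDr ur add0r.
rewrite defect_tpowD [dir u *: (_ + _)]scalerDr [c%:A *: (_ + _)]scalerDr dir_s.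
rewrite defect_tpow_dirL ur mulr0 !scale0r => /addIr /esym.
exact: scalar_eq0.
Qed.

(** The mirror image of [defect_tpow_neq1]: in
    delta_(s+r) = delta_s t^r + t^s delta_r, the term t^s delta_r is the one of
    weight 0 under d_u on the right. *)
Lemma defect_tpow_neq0 u r s v : b != 0 -> dot u r = 0 -> dot u s != 0 ->
  defect (tpow F r) v = 0.
Proof.
move=> b0 ur us; apply: (@tpow_eq0 _ _ s); set c := - (b * dot u s).
have c0 : c != 0 by rewrite oppr_eq0 mulf_neq0.
have dir_s : defect (tpow F s) (tpow F r *: (dir u *: v)) =
    c%:A *: defect (tpow F s) (tpow F r *: v).
  by rewrite scalerA -tpow_dirC // -scalerA defect_tpow_dirR.
have := defect_tpowD s r (dir u *: v).
rewrite dir_s !defect_tpow_dirR dotmulDr ur addr0 mulr0 oppr0 !scale0r.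
rewrite scaler0 addr0 defect_tpowD -/c [c%:A *: (_ + _)]scalerDr.
rewrite -[RHS]addr0 => /addrI.
exact: scalar_eq0.
Qed.

Lemma defect_tpow r v : defect (tpow F r) v = 0.
Proof.
have [->|r0] := eqVneq r 0; first by rewrite tpow0 defect1.
have [u [s [ur us]]] := exists_orthogonal F n_ge2 r0.
have [b1|b1] := eqVneq b 1.
  by apply: defect_tpow_neq0 ur us; rewrite b1 oner_eq0.
have -> : v = tpow F s *: (tpow F (- s) *: v).
  by rewrite scalerA tpowM subrr tpow0 scale1r.
exact: defect_tpow_neq1 ur us.
Qed.

Lemma twist_intertwiner_linear p v : phi (p *: v) = p *: phi v.
Proof.
apply/eqP; rewrite -subr_eq0 -/(defect p v); apply/eqP.
elim/diffop_ind: p v => [k|i|a p q dp dq|p q dp dq] v.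
- exact: defect_tpow.
- by rewrite -dir_delta defect_dir.
- by rewrite defectD defectZ dp dq scaler0 addr0.
- by rewrite defectM dp dq scaler0 addr0.
Qed.

End EqualParameters.

End Intertwiners.

(** * The isomorphism theorem *)

Theorem theorem11 (R : realType) (n : nat) (b b' : R[i])
    (A A' : lmodType (diffop R[i] n)) :
  (2 <= n)%N ->
  irreducible_module A -> irreducible_module A' ->
  (witt_iso (twisted A b) (twisted A' b') <-> b = b' /\ module_iso A A').
Proof.
move=> n2 [_ _] [[w0 w0_neq0] _]; split=> [[f [f_bij f_witt]]|[-> [f f_bij]]].
- have f_lin : linear (f : Defs.restrict A -> Defs.restrict A') := linearP f.
  have f_twist u k (v : A) :
      f (twist_op b u k *: v : A) = twist_op b' u k *: (f v : A') :> A'.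
    by rewrite -!twist_opE; apply: f_witt.
  have eq_b : b = b'.
    have [g fK gK] := f_bij; apply/eqP; apply: contraNT w0_neq0 => bb'.
    apply/eqP/(@tpartial_eq0 _ _ A' (Ordinal n2)) => w; rewrite -(gK w).
    exact: tpartial_phi_eq0 f_lin n2 _ _ f_twist _ _ bb'.
  split=> //; subst b'.
  have fK_lin : linear (f : A -> A').
    move=> p v w; rewrite (phiD f_lin).
    by rewrite (twist_intertwiner_linear f_lin n2 f_twist).
  pose fK : GRing.isLinear _ _ _ _ (f : A -> A') :=
    GRing.isLinear.Build _ A A' *:%R _ fK_lin.
  pose fA : {linear A -> A'} := HB.pack (f : A -> A') fK.
  by exists fA.
- have f_lin : linear (f : Defs.restrict A -> Defs.restrict A').
    by move=> a v w; apply: (linearP f).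
  pose fF := GRing.isLinear.Build R[i] (Defs.restrict A) (Defs.restrict A')
    *:%R _ f_lin.
  pose fW : {linear Defs.restrict A -> Defs.restrict A'} :=
    HB.pack (f : Defs.restrict A -> Defs.restrict A') fF.
  exists fW.
  by split=> // X v; apply: linearZ.
Qed.
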